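(* Let $\vec A=(A_0,A_1)$ be a Gagliardo complete ordered pair. Let $F$ be a parameter for the $K$-method on $[0,1]$, and, moreover, suppose that the operator $Tf(t)=f(t^2)/t$ is bounded on $F$. Then, for every family $\{I_\theta\}_{\theta\in(0,1)}$ of exact interpolation functors of exponent $\theta$ (i.e., for each $\theta$, the characteristic function of $I_\theta$ is $t^\theta$), we have $$\Vert a\Vert_{\langle\vec A\rangle_F^K}\asymp\Big\Vert t\cdot\Vert a\Vert_{I_{\theta(t)}(\vec A)}\Big\Vert_F,$$ where $\theta(t)=1+\frac{1}{2\log(t/e)}$, $0<t\le1$, and the constants of this equivalence are universal.
   Context: A Banach pair $\vec A=(A_0,A_1)$ consists of two Banach spaces continuously embedded in a common Hausdorff topological vector space; it is ordered if $A_1\subset A_0$ with embedding of norm at most $1$. For $x\in A_0+A_1$, $t>0$, $K(t,x;\vec A)=\inf\{\Vert a_0\Vert_{A_0}+t\Vert a_1\Vert_{A_1}: x=a_0+a_1,\ a_i\in A_i\}$. The pair is Gagliardo complete if, for $i=0,1$, $A_i$ coincides with its Gagliardo completion $\tilde A_i=\{a\in A_0+A_1:\Vert a\Vert_{\tilde A_i}=\sup_{t>0}t^{-i}K(t,a;\vec A)<\infty\}$ (for an ordered pair only the case $i=1$ is a restriction: the smaller space $A_1$ is Gagliardo complete with respect to the larger space $A_0$). $L^\infty=L^\infty(0,1)$ and $\Vert f\Vert_{L^\infty(1/t)}=\Vert f(t)/t\Vert_{L^\infty}$. A parameter for the $K$-method on $[0,1]$ is a Banach lattice $F$ of measurable functions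 on $((0,1),\frac{dt}{t})$ with continuous embeddings $L^\infty(1/t)\subset F\subset L^\infty$; $\langle\vec A\rangle_F^K=\{x\in A_0+A_1:\Vert x\Vert_{\langle\vec A\rangle_F^K}:=\Vert K(\cdot,x;\vec A)\Vert_F<\infty\}$. An exact interpolation functor $I$ assigns to each Banach pair $\vec A$ a Banach space $I(\vec A)$ with $A_0\cap A_1\subset I(\vec A)\subset A_0+A_1$ such that every linear $S:A_0+A_1\to B_0+B_1$ bounded from $A_i$ to $B_i$, $i=0,1$, satisfies $\Vert S\Vert_{I(\vec A)\to I(\vec B)}\le\max_{i=0,1}\Vert S\Vert_{A_i\to B_i}$. Its characteristic function $\rho$ is defined by $I(\mathbb{K},\alpha^{-1}\mathbb{K})=\rho(\alpha)^{-1}\mathbb{K}$ (isometrically), $\alpha>0$, where $\mathbb{K}$ is the scalar field and $\beta\mathbb{K}$ denotes $\mathbb K$ with the norm $\beta|\cdot|$. The symbol $\asymp$ denotes two-sided estimates up to positive multiplicative constants.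
   Formalization: The constants are independent of the pair A, the family I_θ and the element a, but may depend on F; constants independent of F are impossible, e.g. for F = L^∞(1/(t log^M(e^B/t))), B > M, and the (θ,1) J-method, as M grows. *)

(* Defs.v *)
From HB Require Import structures.
From mathcomp Require Import all_boot all_order all_algebra.
From mathcomp Require Import complex.
From mathcomp Require Import all_classical all_reals all_analysis.

Set Implicit Arguments.
Unset Strict Implicit.
Unset Printing Implicit Defensive.

Import Order.TTheory GRing.Theory Num.Theory.
Import numFieldNormedType.Exports.

Local Open Scope classical_set_scope.
Local Open Scope ring_scope.

(* The library's norms on a K-normed space are K-valued; [re_part] turns them
   into elements of R, whether K is R or R[i]. *)
Variant scalars := RealScalars | ComplexScalars.

Definition scalar_field (R : realType) (s : scalars) : numFieldType :=
  match s with
  | RealScalars => R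
  | ComplexScalars => R[i]
  end.

Definition re_part (R : realType) (s : scalars) : scalar_field R s -> R :=
  match s with
  | RealScalars => fun x => x
  | ComplexScalars => fun x => complex.Re x
  end.

Definition of_real (R : realType) (s : scalars) : R -> scalar_field R s :=
  match s with
  | RealScalars => fun x => x
  | ComplexScalars => fun x => (x%:C)%C
  end.
Arguments of_real {R} s.

Definition rnorm (R : realType) (s : scalars)
    (V : normedModType (scalar_field R s)) (v : V) : R := re_part `|v|.

Section scalar_field_facts.
Variables (R : realType) (s : scalars).
Local Notation K := (scalar_field R s).

Lemma of_real_gt0 (b : R) : 0 < b -> 0 < of_real s b.
Proof. by case: s => //= b0; rewrite ltcR. Qed.

Lemma of_realK : cancel (of_real s) (@re_part R s).
Proof. by case: s. Qed.

Lemma re_partM (b : R) (x : K) : re_part (of_real s b * x) = b * re_part x.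
Proof.
by case: s x => //= -[x y] /=; rewrite mul0r subr0.
Qed.

Lemma re_part_ge0 (x : K) : 0 <= x -> 0 <= re_part x.
Proof. by case: s x => //= -[x y]; rewrite lecE /= => /andP[]. Qed.

Lemma scalar_field_complete (F : set_system K) : ProperFilter F ->
  (forall e : K, 0 < e -> exists x, F (ball_ Num.norm x e)) ->
  exists l : K, forall e : K, 0 < e -> F (ball_ Num.norm l e).
Proof.
have normi_mul (z : R[i]) : `|'i%C * z| = `|z|.
  have := normc_def ('i%C : R[i]); rewrite /= expr0n expr1n add0r sqrtr1 => i1.
  by rewrite normrM i1 mul1r.
case: s F => /= F FF Fc.
  have /R_complete : cauchy (F : set_system R).
    by apply/cauchyP => e /Fc[x Fx]; exists x.
  move=> /cvg_ex[l /cvg_ballP Fl]; exists l => e /Fl.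
  by rewrite /ball /=.
have ImRe (x y : R[i]) (e : R) : `|x - y| < e%:C%C ->
    `|complex.Re x - complex.Re y| < e /\ `|complex.Im x - complex.Im y| < e.
  move=> xye; split; rewrite -ltcR; apply: le_lt_trans xye.
    have := normc_ge_Re (x - y).
    by case: x y => [? ?] [? ?].
  have := normc_ge_Re ('i%C * (x - y)).
  rewrite normi_mul; case: x y => [? ?] [? ?] /=.
  by rewrite !(mul0r, mul1r, sub0r, add0r) normrN.
have eC (e : R[i]) : 0 < e -> e = (complex.Re e)%:C%C /\ 0 < complex.Re e.
  by case: e => a b; rewrite ltcE /= => /andP[/eqP ->].
pose FRe : set_system R := fmap (@complex.Re R) F.
pose FIm : set_system R := fmap (@complex.Im R) F.
have cRe : cauchy FRe.
  apply/cauchyP => e e0; have [|x Fx] := Fc e%:C%C; first by rewrite ltcR.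
  exists (complex.Re x); rewrite /FRe /fmap /=.
  by apply: filterS Fx => y /= /ImRe[].
have cIm : cauchy FIm.
  apply/cauchyP => e e0; have [|x Fx] := Fc e%:C%C; first by rewrite ltcR.
  exists (complex.Im x); rewrite /FIm /fmap /=.
  by apply: filterS Fx => y /= /ImRe[].
have /cvg_ex[a /cvg_ballP Fa] : cvg FRe by exact: R_complete.
have /cvg_ex[b /cvg_ballP Fb] : cvg FIm by exact: R_complete.
exists (Complex a b) => z /eC[-> ]; move: (complex.Re z) => {z} e e0.
have e20 : 0 < e / 2 by rewrite divr_gt0.
have FI : F ([set z | ball a (e / 2) (complex.Re z)] `&`
             [set z | ball b (e / 2) (complex.Im z)]).
  by apply: filterI; [exact: Fa | exact: Fb].
apply: filterS FI => -[x y] [] /=; rewrite /ball /= => xe ye.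
have -> : Complex a b - Complex x y = (a - x)%:C%C + 'i%C * (b - y)%:C%C.
  by rewrite [LHS]complexE.
apply: le_lt_trans (ler_normD _ _) _.
rewrite normi_mul.
rewrite !normc_def /= expr0n /= !addr0 !sqrtr_sqr -rmorphD /= ltcR.
by rewrite [ltRHS](splitr e) ltrD.
Qed.

End scalar_field_facts.

(* A Banach space continuously embedded in V; [emb] identifies it with the
   subspace [range emb] of V. *)
Record banach_in (R : realType) (s : scalars)
    (V : topologicalLmodType (scalar_field R s)) := BanachIn {
  space :> completeNormedModType (scalar_field R s);
  emb : {linear space -> V};
  emb_inj : injective emb;
  emb_continuous : continuous (emb : space -> V) }.
Arguments emb {R s V}.

Record banach_pair (R : realType) (s : scalars) := BanachPair {
  ambient : topologicalLmodType (scalar_field R s);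
  ambient_hausdorff : hausdorff_space ambient;
  space0 : banach_in ambient;
  space1 : banach_in ambient }.

Section banach_pairs.
Variables (R : realType) (s : scalars).
Local Notation K := (scalar_field R s).

(* As [emb A] is injective, the infimum ranges over at most one value; it is
   +oo when x does not lie in A. *)
Definition space_norm (V : topologicalLmodType K) (A : banach_in V) (x : V) :
    \bar R :=
  ereal_inf [set (rnorm a)%:E | a in [set a : A | emb A a = x]].

(* S maps A into B with norm at most M. *)
Definition bounded_by (V W : topologicalLmodType K) (A : banach_in V)
    (B : banach_in W) (S : V -> W) (M : R) :=
  forall a : A, exists2 b : B, emb B b = S (emb A a) & rnorm b <= M * rnorm a.

Definition linear_on (V W : lmodType K) (D : set V) (S : V -> W) :=
  forall (k : K) x y, D x -> D y -> S (k *: x + y) = k *: S x + S y.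

Variable A : banach_pair R s.

Definition pair_sum : set (ambient A) :=
  [set x | exists (a0 : space0 A) (a1 : space1 A),
             x = emb (space0 A) a0 + emb (space1 A) a1].

Definition pair_inter : set (ambient A) :=
  range (emb (space0 A)) `&` range (emb (space1 A)).

Definition ordered := bounded_by (space1 A) (space0 A) id 1.

Definition K_functional (t : R) (x : ambient A) : \bar R :=
  ereal_inf [set r | exists (a0 : space0 A) (a1 : space1 A),
    x = emb (space0 A) a0 + emb (space1 A) a1 /\
    r = (rnorm a0 + t * rnorm a1)%:E].

Definition gagliardo_norm (i : nat) (x : ambient A) : \bar R :=
  ereal_sup [set ((t ^- i)%:E * K_functional t x)%E | t in [set t | 0 < t]].

Definition gagliardo_completion (i : nat) : set (ambient A) :=
  [set x | pair_sum x /\ (gagliardo_norm i x < +oo)%E].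

(* Equality as subspaces of the ambient space; the norms are then equivalent
   by the open mapping theorem. *)
Definition gagliardo_complete :=
  range (emb (space0 A)) = gagliardo_completion 0 /\
  range (emb (space1 A)) = gagliardo_completion 1.

End banach_pairs.

(* beta K : the scalar field with the norm beta |.| *)
Definition scaled_field (R : realType) (s : scalars) (beta : {posnum R}) : Type :=
  (scalar_field R s)^o.

Section scaled_field_instances.
Variables (R : realType) (s : scalars) (beta : {posnum R}).
Local Notation K := (scalar_field R s).
Local Notation bK := (scaled_field s beta).

HB.instance Definition _ := GRing.Lmodule.copy bK K^o.

Definition scaled_norm (x : bK) : K := of_real s beta%:num * `|x : K|.

Let scaled_normD (x y : bK) :
  scaled_norm (x + y) <= scaled_norm x + scaled_norm y.
Proof.
by rewrite /scaled_norm -mulrDr ler_wpM2l ?ler_normD // ltW ?of_real_gt0.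
Qed.

Let scaled_normZ (l : K) (x : bK) : scaled_norm (l *: x) = `|l| * scaled_norm x.
Proof. by rewrite /scaled_norm mulrCA -normrM. Qed.

Let scaled_norm0_eq0 (x : bK) : scaled_norm x = 0 -> x = 0.
Proof.
move=> /eqP; rewrite /scaled_norm mulf_eq0 normr_eq0 gt_eqF ?of_real_gt0 //=.
by move=> /eqP.
Qed.

HB.instance Definition _ := Lmodule_isNormed.Build K bK
  scaled_normD scaled_normZ scaled_norm0_eq0.

Let ball_scaledE (x : bK) (e : K) :
  ball x e = ball_ (@Num.norm K K) x (e / of_real s beta%:num).
Proof.
apply/seteqP; split => y;
  by rewrite /ball /= ltr_pdivlMr ?of_real_gt0 // mulrC.
Qed.

Let scaled_complete (F : set_system bK) : ProperFilter F -> cauchy F -> cvg F.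
Proof.
move=> FF /cauchyP Fc; have b0 := of_real_gt0 s [gt0 of beta%:num].
have [e e0|l Fl] := @scalar_field_complete R s F FF.
  have [|x] := Fc (e * of_real s beta%:num); first by rewrite mulr_gt0.
  by rewrite ball_scaledE mulfK ?gt_eqF // => Fx; exists x.
apply/cvg_ex; exists l; apply/cvg_ballP => e e0.
by rewrite /= ball_scaledE; apply: Fl; rewrite divr_gt0.
Qed.

HB.instance Definition _ := Uniform_isComplete.Build bK scaled_complete.

Definition scaled_emb (x : bK) : K^o := x.

HB.instance Definition _ :=
  GRing.isLinear.Build K bK K^o _ scaled_emb (fun _ _ _ => erefl).

Let scaled_emb_inj : injective scaled_emb. Proof. by []. Qed.

Let scaled_emb_continuous : continuous scaled_emb.
Proof.
move=> x P /nbhs_ballP[e /= e0 eP].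
apply/nbhs_ballP; exists (of_real s beta%:num * e) => /=.
  by rewrite mulr_gt0 // of_real_gt0.
move=> y; rewrite ball_scaledE mulrAC mulfV ?mul1r; first exact: eP.
by rewrite gt_eqF // of_real_gt0.
Qed.

Definition scaled_line : banach_in K^o :=
  BanachIn scaled_emb_inj scaled_emb_continuous.

Lemma rnorm_scaled (x : scaled_line) :
  rnorm x = beta%:num * re_part `|x : K|.
Proof. exact: re_partM. Qed.

End scaled_field_instances.

(* the pair (K, alpha^-1 K) *)
Definition scalar_pair (R : realType) (s : scalars) (alpha : {posnum R}) :
    banach_pair R s :=
  BanachPair (@norm_hausdorff _ (scalar_field R s)^o)
    (scaled_line s 1%:pos) (scaled_line s (alpha%:num^-1)%:pos).

Record exact_functor (R : realType) (s : scalars) := ExactFunctor {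
  interp :> forall A : banach_pair R s, banach_in (ambient A);
  inter_sub_interp : forall A, @pair_inter R s A `<=` range (emb (interp A));
  interp_sub_sum : forall A, range (emb (interp A)) `<=` @pair_sum R s A;
  interp_exact : forall (A B : banach_pair R s) (S : ambient A -> ambient B)
      (M0 M1 : R),
    linear_on (@pair_sum R s A) S ->
    bounded_by (space0 A) (space0 B) S M0 ->
    bounded_by (space1 A) (space1 B) S M1 ->
    bounded_by (interp A) (interp B) S (Num.max M0 M1) }.

Definition has_characteristic_function (R : realType) (s : scalars)
    (I : exact_functor R s) (rho : R -> R) :=
  forall (alpha : {posnum R}) (x : scalar_field R s),
    space_norm (I (scalar_pair s alpha)) x =
    ((rho alpha%:num)^-1 * re_part `|x|)%:E.

(* The measures dt/t and dt on (0,1) have the same null sets. *)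
Definition ae01 (R : realType) (P : R -> Prop) :=
  {ae (@lebesgue_measure R), forall t : R, 0 < t < 1 -> P t}.

Lemma ae01S (R : realType) (P Q : R -> Prop) :
  (forall t, P t -> Q t) -> ae01 P -> ae01 Q.
Proof.
move=> PQ [N [mN N0 NP]]; exists N; split => // t nQ; apply: NP => Pt.
by apply: nQ => /Pt /PQ.
Qed.

Definition measurable01 (R : realType) (f : R -> R) :=
  measurable_fun (`]0, 1[%classic : set R) f.

(* Functions on (0,1) are represented by functions on R whose values outside
   (0,1) are irrelevant, and identified when a.e. equal on (0,1). *)
Record banach_lattice (R : realType) := BanachLattice {
  lcar : set (R -> R);
  lnorm : (R -> R) -> R;
  lcar_measurable : forall f, lcar f -> measurable01 f;
  lcar0 : lcar (cst 0);
  lcarD : forall f g, lcar f -> lcar g -> lcar (f \+ g);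
  lcarZ : forall (k : R) f, lcar f -> lcar (k \*o f);
  lnormD : forall f g, lcar f -> lcar g -> lnorm (f \+ g) <= lnorm f + lnorm g;
  lnormZ : forall (k : R) f, lcar f -> lnorm (k \*o f) = `|k| * lnorm f;
  lnorm_eq0 : forall f, lcar f -> lnorm f = 0 -> ae01 (fun t => f t = 0);
  lattice_ideal : forall f g : R -> R, measurable01 f -> lcar g ->
    ae01 (fun t => `|f t| <= `|g t|) -> lcar f /\ lnorm f <= lnorm g;
  lattice_complete : forall u : nat -> R -> R, (forall n, lcar (u n)) ->
    (forall e, 0 < e -> exists N, forall m n, (N <= m)%N -> (N <= n)%N ->
      lnorm (u m \- u n) < e) ->
    exists2 f, lcar f & lnorm (u n \- f) @[n --> \oo] --> 0 }.

Section lattices.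
Variables (R : realType) (F : banach_lattice R).

(* continuous embeddings L^oo(1/t) c F c L^oo *)
Definition is_parameter :=
  (exists C : R, forall (f : R -> R) (M : R),
     measurable01 f -> ae01 (fun t => `|f t / t| <= M) ->
     lcar F f /\ lnorm F f <= C * M) /\
  (exists C : R, forall f : R -> R, lcar F f ->
     ae01 (fun t => `|f t| <= C * lnorm F f)).

Definition bounded_on (T : (R -> R) -> R -> R) :=
  exists C : R, forall f, lcar F f ->
    lcar F (T f) /\ lnorm F (T f) <= C * lnorm F f.

(* The norm of F, extended to arbitrary functions with extended real values:
   +oo for a measurable function that does not belong to F, and the infimum of
   the norms of the majorants in F in general. *)
Definition lattice_norm (g : R -> \bar R) : \bar R :=
  ereal_inf [set (lnorm F h)%:E | h in
    [set h | lcar F h /\ ae01 (fun t => (`|g t| <= (h t)%:E)%E)]].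

End lattices.

Section lattice_norm_facts.
Variables (R : realType) (F : banach_lattice R).

Lemma lattice_normE (f : R -> R) : lcar F f ->
  lattice_norm F (EFin \o f) = (lnorm F f)%:E.
Proof.
move=> Ff; apply/eqP; rewrite eq_le; apply/andP; split; last first.
  apply: le_ereal_inf_tmp => _ [h [Fh fh] <-]; rewrite lee_fin.
  have [|_ ->//] := lattice_ideal (lcar_measurable Ff) Fh.
  apply: ae01S fh => t /=; rewrite lee_fin => /le_trans; apply.
  exact: ler_norm.
have mf : measurable01 (fun t => `|f t|).
  exact: measurableT_comp (lcar_measurable Ff).
have [|Fn fn] := lattice_ideal mf Ff.
  by apply: aeW => t _; rewrite normr_id.
apply: (@le_trans _ _ (lnorm F (fun t => `|f t|))%:E); last by rewrite lee_fin.
apply: ereal_inf_lbound; exists (fun t => `|f t|) => //; split => //.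
by apply: aeW => t _.
Qed.

Lemma lattice_norm_pinfty (f : R -> R) : measurable01 f ->
  ~ lcar F f -> lattice_norm F (EFin \o f) = +oo%E.
Proof.
move=> mf Ff; rewrite /lattice_norm [X in ereal_inf X](_ : _ = set0).
  by rewrite ereal_inf0.
apply/seteqP; split => // y [h [Fh fh] _]; apply: Ff.
apply: (proj1 (lattice_ideal mf Fh _)).
apply: ae01S fh => t /=; rewrite lee_fin => /le_trans; apply.
exact: ler_norm.
Qed.

End lattice_norm_facts.

Definition K_method_norm (R : realType) (s : scalars) (F : banach_lattice R)
    (A : banach_pair R s) (x : ambient A) : \bar R :=
  lattice_norm F (fun t => K_functional t x).

(* Main.v *)
Require Import Defs.
From mathcomp Require Import all_boot all_order all_algebra.
From mathcomp Require Import complex.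
From mathcomp Require Import all_classical all_reals all_analysis.
From mathcomp Require Import measurable_realfun ring lra.
Import Order.TTheory GRing.Theory Num.Theory.
Import numFieldNormedType.Exports.
Local Open Scope classical_set_scope.
Local Open Scope ring_scope.

(* A functor I of exponent theta satisfies K(t,a) <= t^theta |a|_I (map A to
   the scalar pair by a Hahn-Banach functional) and
   |a|_I <= t^-theta max(|a|_0, t |a|_1) (map the scalar pair to A). For
   theta = theta(t), t^theta is comparable to t, so the first bound gives one
   half of the theorem.

   For the other half put t_n = t^(2^n), choose almost optimal decompositions
   a = x_n + y_n for K(t_n,a), and write a = y_0 + sum_n (y_(n+1) - y_n). The
   second bound at t_n controls the n-th term by
   2 t_n^(1-theta) K(t_(n+1),a) / t_(n+1). Here K(t_n,a) / t_n is
   (T^n K(.,a))(t) / t, and for t <= 1/e the factor t_n^(1-theta) is at most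
   exp(-2^n/4), which beats the powers of the norm of T on F; so the sum of the
   series lies in F. For t > 1/e, a fixed good point of (e^-2, e^-1) is used in
   place of t, and the bound is a constant multiple of t, a function of F. *)

(** * Real and complex scalars treated uniformly, with real-valued norms *)

Section scalars.
Context {R : realType} {s : scalars}.
Local Notation K := (scalar_field R s).
Implicit Types (x y : K) (a b : R).

Lemma of_realD a b : of_real s (a + b) = of_real s a + of_real s b.
Proof. by case: s => //=; rewrite rmorphD. Qed.

Lemma of_realM a b : of_real s (a * b) = of_real s a * of_real s b.
Proof. by case: s => //=; rewrite rmorphM. Qed.

Lemma of_real1 : of_real s 1 = 1 :> K.
Proof. by case: s. Qed.

Lemma of_real0 : of_real s 0 = 0 :> K.
Proof. by case: s. Qed.

Lemma of_realN a : of_real s (- a) = - of_real s a.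
Proof. by case: s => //=; rewrite rmorphN. Qed.

Lemma re_partK x : 0 <= x -> of_real s (re_part x) = x.
Proof. by case: s x => //= -[x y]; rewrite lecE /= => /andP[/eqP ->]. Qed.

Lemma le_of_real a b : (of_real s a <= of_real s b) = (a <= b).
Proof. by case: s => //=; rewrite lecR. Qed.

Lemma lt_of_real a b : (of_real s a < of_real s b) = (a < b).
Proof. by case: s => //=; rewrite ltcR. Qed.

Lemma re_partD x y : re_part (x + y) = re_part x + re_part y.
Proof. by case: s x y => //= -[? ?] []. Qed.

Lemma re_part_le x y : x <= y -> re_part x <= re_part y.
Proof. by case: s x y => //= -[x1 x2] [y1 y2]; rewrite lecE /= => /andP[]. Qed.

Lemma re_part_normM x y : re_part `|x * y| = re_part `|x| * re_part `|y|.
Proof. by rewrite normrM -{1}[`|x|]re_partK// re_partM. Qed.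

Lemma norm_of_real a : 0 <= a -> `|of_real s a| = of_real s a.
Proof. by move=> a0; rewrite ger0_norm// -of_real0 le_of_real. Qed.

Context {V : normedModType K}.
Implicit Types v w : V.

Lemma norm_rnorm v : `|v| = of_real s (rnorm v).
Proof. by rewrite /rnorm re_partK. Qed.

Lemma rnorm_ge0 v : 0 <= rnorm v.
Proof. exact: re_part_ge0. Qed.

Lemma rnormD v w : rnorm (v + w) <= rnorm v + rnorm w.
Proof. by rewrite /rnorm -re_partD re_part_le// ler_normD. Qed.

Lemma rnormZ x v : rnorm (x *: v) = re_part `|x| * rnorm v.
Proof. by rewrite /rnorm normrZ -{1}[`|x|]re_partK// re_partM. Qed.

Lemma rnormN v : rnorm (- v) = rnorm v.
Proof. by rewrite /rnorm normrN. Qed.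

Lemma rnorm0 : rnorm (0 : V) = 0.
Proof. by rewrite /rnorm normr0; case: s. Qed.

End scalars.

(** * The Hahn-Banach theorem for a seminorm, over R or C *)

Section hahn_banach.
Context {R : realType} {s : scalars} {V : lmodType (scalar_field R s)}.
Implicit Types (p q : V -> R) (x y : V) (r : R).
Local Notation "r *r x" := (of_real s r *: x) (at level 40).

(** Homogeneity is asked only as an inequality, which is easier to check for infima; using it with
    [r^-1] gives equality. *)
Definition sublinear q :=
  (forall x y, q (x + y) <= q x + q y) /\
  (forall r x, 0 < r -> q (r *r x) <= r * q x).

Let scale_realA a b x : a *r (b *r x) = (a * b) *r x.
Proof. by rewrite scalerA -of_realM. Qed.

Let scale_real1 x : 1 *r x = x.
Proof. by rewrite of_real1 scale1r. Qed.

Lemma sublinear_homo {q r} x : sublinear q -> 0 < r -> q (r *r x) = r * q x.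
Proof.
move=> [_ qZ] r0; apply/eqP; rewrite eq_le qZ//=.
have := qZ r^-1 (r *r x); rewrite invr_gt0 => /(_ r0).
by rewrite scale_realA mulVf ?gt_eqF// scale_real1 ler_pdivlMl.
Qed.

Lemma sublinear0 {q} : sublinear q -> q 0 = 0.
Proof.
move=> sq; have := @sublinear_homo q 2 0 sq; rewrite scaler0 ltr0n => /(_ erefl).
lra.
Qed.

Lemma sublinearN {q} x : sublinear q -> - q (- x) <= q x.
Proof.
by move=> sq; have := sq.1 x (- x); rewrite subrr (sublinear0 sq); lra.
Qed.

Lemma sublinear_lb {p q} x : sublinear q -> (forall x, q x <= p x) ->
  - p (- x) <= q x.
Proof.
move=> sq qp; apply: le_trans (sublinearN x sq).
by rewrite lerN2 qp.
Qed.

(* Replacing q by [x |-> inf_(t > 0) (q (x + t y) - t q y)] makes it linear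
   along y; a minimal sublinear q is fixed by this for all y. *)
Definition flatten_along q y x :=
  inf [set q (x + t *r y) - t * q y | t in [set t | 0 < t]].

Section flatten.
Variables (q : V -> R) (y : V).
Hypothesis sq : sublinear q.

Let flat_has_inf x :
  has_inf [set q (x + t *r y) - t * q y | t in [set t | 0 < t]].
Proof.
split; first by exists (q (x + 1 *r y) - 1 * q y), 1 => //=.
exists (- q (- x)) => _ [t /= t0 <-].
have := sq.1 (x + t *r y) (- x).
by rewrite addrAC subrr add0r (sublinear_homo y sq)//; lra.
Qed.

Lemma flatten_along_le x t : 0 < t ->
  flatten_along q y x <= q (x + t *r y) - t * q y.
Proof.
by move=> t0; apply: (ge_inf (flat_has_inf x).2); exists t.
Qed.

Lemma flatten_along_ge x z :
  (forall t, 0 < t -> z <= q (x + t *r y) - t * q y) ->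
  z <= flatten_along q y x.
Proof.
move=> zle; apply: lb_le_inf; first exact: (flat_has_inf x).1.
by move=> _ [t /= t0 <-]; exact: zle.
Qed.

Lemma flatten_along_ler x : flatten_along q y x <= q x.
Proof.
apply: le_trans (flatten_along_le x 1 ltr01) _.
by have := sq.1 x (1 *r y); rewrite (sublinear_homo y sq)//; lra.
Qed.

(** For subadditivity the parameters [t] and [u] of the two infima are added; for homogeneity [t] is
    replaced by [r * t]. *)
Lemma sublinear_flatten : sublinear (flatten_along q y).
Proof.
split=> [x z|r x r0].
  rewrite -lerBlDr; apply: flatten_along_ge => t t0.
  rewrite lerBlDr -lerBlDl; apply: flatten_along_ge => u u0.
  have := flatten_along_le (x + z) (t + u); rewrite addr_gt0// => /(_ erefl).
  have := sq.1 (x + t *r y) (z + u *r y).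
  by rewrite addrACA -scalerDl -of_realD; lra.
rewrite -ler_pdivrMl//; apply: flatten_along_ge => t t0.
rewrite ler_pdivrMl//; apply: le_trans (flatten_along_le (r *r x) (r * t) _) _.
  exact: mulr_gt0.
by rewrite -scale_realA -scalerDr (sublinear_homo _ sq)// mulrBr mulrA.
Qed.

End flatten.

(** Zorn's lemma: a nonempty chain is bounded below by its pointwise infimum, which is finite
    because every member is at least [- p (- x)]. *)
Lemma sublinear_minimal p : sublinear p -> exists q,
  [/\ sublinear q, forall x, q x <= p x &
  forall q', sublinear q' -> (forall x, q' x <= q x) -> forall x, q x <= q' x].
Proof.
move=> sp; pose P q := sublinear q /\ forall x, q x <= p x; pose T := {q | P q}.
have t0 : T by exists p.
pose S (a b : T) := `[< forall x, sval b x <= sval a x >].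
have [|a b c /asboolP ab /asboolP bc|A totA|q qmin] := ZL_preorder t0 (R := S).
- by move=> t; apply/asboolP.
- by apply/asboolP => x; exact: le_trans (ab x).
- have [->|/set0P[a0 Aa0]] := eqVneq A set0; first by exists t0.
  pose E x := [set sval a x | a in A].
  have Ei x : has_inf (E x).
    split; first by exists (sval a0 x), a0.
    exists (- p (- x)) => _ [[a [sa ap]] _ <-]/=; exact: sublinear_lb.
  have Ele x a : A a -> inf (E x) <= sval a x.
    by move=> Aa; apply: (ge_inf (Ei x).2); exists a.
  have Ege x z : (forall a, A a -> z <= sval a x) -> z <= inf (E x).
    by move=> za; apply: (lb_le_inf (Ei x).1) => _ [a Aa <-]; exact: za.
  have sE : sublinear (fun x => inf (E x)).
    split=> [x y|r x r0].
      rewrite -lerBlDr; apply: (Ege _ _) => a Aa; rewrite lerBlDr -lerBlDl.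
      apply: (Ege _ _) => b Ab; rewrite lerBlDl.
      (* Of two members of the chain the smaller one serves both arguments, so the infimum stays
         subadditive. *)
      have [/asboolP ba|/asboolP ab] := totA _ _ Aa Ab.
        apply: le_trans (Ele _ _ Ab) _.
        apply: le_trans ((svalP b).1.1 x y) _.
        by rewrite lerD2r ba.
      apply: le_trans (Ele _ _ Aa) _.
      apply: le_trans ((svalP a).1.1 x y) _.
      by rewrite lerD2l ab.
    rewrite -ler_pdivrMl//; apply: (Ege _ _) => a Aa; rewrite ler_pdivrMl//.
    by apply: le_trans (Ele _ _ Aa) _; exact: (svalP a).1.2.
  have Ep x : inf (E x) <= p x.
    by apply: le_trans (Ele _ _ Aa0) _; exact: (svalP a0).2.
  exists (exist P _ (conj sE Ep)) => a Aa; apply/asboolP => x /=.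
  exact: Ele.
exists (sval q); split; [exact: (svalP q).1|exact: (svalP q).2|].
move=> q' sq' q'q x.
have q'p y : q' y <= p y by apply: le_trans (q'q y) _; exact: (svalP q).2.
have := qmin (exist P _ (conj sq' q'p)).
by rewrite /S => /(_ (asboolT q'q))/asboolP.
Qed.

(** The minimal functional is taken below [flatten_along p v], whose value at [- v] is at most
    [p 0 - p v]; this forces [g v >= p v]. *)
Lemma real_hahn_banach p v : sublinear p -> exists g : V -> R,
  [/\ forall x y, g (x + y) = g x + g y,
      forall r x, g (r *r x) = r * g x,
      forall x, g x <= p x & g v = p v].
Proof.
move=> sp.
have [g [sg gp gmin]] := sublinear_minimal _ (sublinear_flatten _ v sp).
have gD x y : g (x + y) = g x + g y.
  apply/eqP; rewrite eq_le sg.1/=.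
  (* Minimality of [g] against its flattening along [y], with [t = 1], gives
     [g x <= g (x + y) - g y]. *)
  have := gmin _ (sublinear_flatten _ y sg) (flatten_along_ler _ y sg) x.
  move=> /le_trans/(_ (flatten_along_le _ _ sg x 1 ltr01)).
  by rewrite scale_real1; lra.
have gN x : g (- x) = - g x.
  by have := gD x (- x); rewrite subrr (sublinear0 sg); lra.
exists g; split => //.
- move=> r x; have [r0|r0|->] := ltgtP r 0.
  + rewrite -[r]opprK of_realN scaleNr gN (sublinear_homo _ sg) ?oppr_gt0//.
    by rewrite !mulNr.
  + by rewrite (sublinear_homo _ sg).
  + by rewrite of_real0 scale0r (sublinear0 sg) mul0r.
- by move=> x; apply: le_trans (gp x) (flatten_along_ler _ _ sp x).
- apply/eqP; rewrite eq_le (le_trans (gp v) (flatten_along_ler _ _ sp v))/=.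
  have := le_trans (gp (- v)) (flatten_along_le _ _ sp (- v) 1 ltr01).
  by rewrite gN scale_real1 addNr (sublinear0 sp); lra.
Qed.

End hahn_banach.

Lemma hahn_banach_seminorm {R : realType} {s : scalars}
    {V : lmodType (scalar_field R s)} (p : V -> R) (v : V) :
  (forall x y, p (x + y) <= p x + p y) ->
  (forall k x, p (k *: x) = re_part `|k| * p x) ->
  exists f : V -> scalar_field R s,
  [/\ forall k x y, f (k *: x + y) = k * f x + f y,
      forall x, re_part `|f x| <= p x & p v <= re_part `|f v|].
Proof.
move=> pD pZ.
have sp : sublinear p.
  by split=> // r x r0; rewrite pZ norm_of_real ?(ltW r0)// of_realK.
have [g [gD gZ gp gv]] := real_hahn_banach p v sp.
case: s V p v pD pZ sp g gD gZ gp gv => V p v pD pZ sp g gD gZ gp gv.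
  exists g; split => /=.
  - by move=> k x y; rewrite gD gZ.
  - move=> x; rewrite ler_norml gp andbT lerNl.
    have := gp (of_real RealScalars (-1) *: x); rewrite gZ pZ/=.
    by rewrite normrN1 mul1r mulN1r.
  - by rewrite gv ler_norm.
(* This is the only complex-linear functional with real part [g]. *)
pose f x : R[i] := (g x -i* g ('i%C *: x))%C.
have fD x y : f (x + y) = f x + f y.
  by rewrite /f scalerDr !gD; simpc.
have fZ k x : f (k *: x) = k * f x.
  have gk (z : R[i]) w :
      g (z *: w) = complex.Re z * g w + complex.Im z * g ('i%C *: w).
    rewrite -!gZ -gD; congr g.
    by rewrite scalerA -scalerDl; congr (_ *: _); case: z => a b; simpc.
  rewrite /f scalerA (gk k) (gk ('i%C * k)).
  by case: k => a b; simpc; congr (_ +i* _)%C => /=; ring.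
have gf x : g x <= complex.Re `|f x|.
  apply: le_trans (ler_norm _) _.
  exact: (@re_part_le R ComplexScalars _ _ (normc_ge_Re (f x))).
exists f; split.
- by move=> k x y; rewrite fD fZ.
- move=> x; have [->|fx0] := eqVneq (f x) 0.
    have := sp.1 x (- x); rewrite subrr (sublinear0 sp) normr0/=.
    by rewrite -scaleN1r pZ normrN1/= mul1r; lra.
  (* The unimodular factor [c] rotates [f x] onto the positive axis, where [f] equals its real part
     [g <= p]. *)
  pose c := `|f x| / f x.
  have c1 : `|c| = 1 by rewrite normrM normfV normr_id divff// normr_eq0.
  have fcx : f (c *: x) = `|f x| by rewrite fZ /c divfK.
  have := gp (c *: x); rewrite pZ c1/= mul1r.
  by rewrite -[g _]/(complex.Re (f (c *: x))) fcx.
- by rewrite -gv; exact: gf.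
Qed.

(** * The K-functional as a real-valued seminorm on A_0 *)

Section K_functional_theory.
Context {R : realType} {s : scalars} {A : banach_pair R s}.
Local Notation A0 := (space0 A).
Local Notation A1 := (space1 A).
Local Notation e0 := (emb (space0 A)).
Local Notation e1 := (emb (space1 A)).
Implicit Types (t z : R) (x y : A0).

Lemma space_norm_emb {V : topologicalLmodType (scalar_field R s)}
    (E : banach_in V) (e : E) : space_norm E (emb E e) = (rnorm e)%:E.
Proof.
rewrite /space_norm [X in ereal_inf X](_ : _ = [set (rnorm e)%:E]).
  by rewrite ereal_inf1.
apply/seteqP; split=> [_ [f /= /(@emb_inj _ _ _ E) -> <-]//|_ ->].
by exists e.
Qed.

(** For [t >= 0] the decomposition [x = x + 0] makes the infimum finite, so [fine] loses nothing.
    For an ordered pair A_0 is the whole sum, hence [x] is taken there. *)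
Definition Kreal t x := fine (K_functional t (e0 x)).

Lemma K_functionalE t x : 0 <= t -> K_functional t (e0 x) = (Kreal t x)%:E.
Proof.
move=> t0; rewrite fineK// ge0_fin_numE; last first.
  apply: le_ereal_inf_tmp => _ [a0 [a1 [_ ->]]].
  by rewrite lee_fin addr_ge0 ?mulr_ge0 ?rnorm_ge0.
apply: (@le_lt_trans _ _ (rnorm x)%:E); last by rewrite ltry.
apply: ereal_inf_lbound; exists x, 0; split; first by rewrite linear0 addr0.
by rewrite rnorm0 mulr0 addr0.
Qed.

Lemma Kreal_le t x b0 b1 : 0 <= t -> e0 x = e0 b0 + e1 b1 ->
  Kreal t x <= rnorm b0 + t * rnorm b1.
Proof.
move=> t0 xb; rewrite -lee_fin -K_functionalE//.
by apply: ereal_inf_lbound; exists b0, b1.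
Qed.

Lemma Kreal_ge z t x : 0 <= t ->
  (forall b0 b1, e0 x = e0 b0 + e1 b1 -> z <= rnorm b0 + t * rnorm b1) ->
  z <= Kreal t x.
Proof.
move=> t0 zb; rewrite -lee_fin -K_functionalE//.
by apply: le_ereal_inf_tmp => _ [b0 [b1 [xb ->]]]; rewrite lee_fin zb.
Qed.

Lemma Kreal_decomposition z t x : 0 <= t -> Kreal t x < z ->
  exists b0 b1, e0 x = e0 b0 + e1 b1 /\ rnorm b0 + t * rnorm b1 < z.
Proof.
move=> t0; rewrite -lte_fin -K_functionalE//.
by move=> /ereal_inf_lt[_ [b0 [b1 [xb ->]]]]; rewrite lte_fin; exists b0, b1.
Qed.

Lemma Kreal_ge0 t x : 0 <= t -> 0 <= Kreal t x.
Proof.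
by move=> t0; apply: Kreal_ge => // *; rewrite addr_ge0 ?mulr_ge0 ?rnorm_ge0.
Qed.

Lemma Kreal_le_rnorm t x : 0 <= t -> Kreal t x <= rnorm x.
Proof.
move=> t0; have := @Kreal_le t x x 0 t0; rewrite linear0 rnorm0 mulr0 !addr0.
exact.
Qed.

Lemma KrealD t x y : 0 <= t -> Kreal t (x + y) <= Kreal t x + Kreal t y.
Proof.
move=> t0; rewrite -lerBlDr; apply: Kreal_ge => // b0 b1 xb.
rewrite lerBlDr -lerBlDl; apply: Kreal_ge => // c0 c1 yc; rewrite lerBlDl.
apply: le_trans (@Kreal_le t (x + y) (b0 + c0) (b1 + c1) t0 _) _.
  by rewrite !linearD/= xb yc addrACA.
have := rnormD b0 c0; have := ler_wpM2l t0 (rnormD b1 c1).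
by rewrite mulrDr; lra.
Qed.

Lemma KrealZ t k x : 0 <= t -> Kreal t (k *: x) = re_part `|k| * Kreal t x.
Proof.
move=> t0.
have K00 : Kreal t 0 = 0.
  apply/eqP; rewrite eq_le Kreal_ge0// andbT.
  by apply: le_trans (@Kreal_le_rnorm _ _ t0) _; rewrite rnorm0.
have [->|k0] := eqVneq k 0.
  by rewrite scale0r K00 normr0 -(@of_real0 R s) of_realK mul0r.
have le_K l y : l != 0 -> Kreal t (l *: y) <= re_part `|l| * Kreal t y.
  move=> l0; have rl0 : 0 < re_part `|l|.
    by rewrite -(@lt_of_real R s) re_partK// of_real0 normr_gt0.
  rewrite -ler_pdivrMl//; apply: Kreal_ge => // b0 b1 yb; rewrite ler_pdivrMl//.
  apply: le_trans (@Kreal_le t _ (l *: b0) (l *: b1) t0 _) _.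
    by rewrite !linearZ/= yb scalerDr.
  by rewrite !rnormZ mulrDr mulrCA.
apply/eqP; rewrite eq_le le_K//=.
have := le_K k^-1 (k *: x); rewrite invr_eq0 => /(_ k0).
rewrite scalerA mulVf// scale1r => /(ler_wpM2l (re_part_ge0 (normr_ge0 k))).
rewrite mulrA -re_part_normM divff// normr1 => /le_trans; apply.
by rewrite -(@of_real1 R s) of_realK mul1r.
Qed.

Lemma Kreal_mono t u x : 0 <= t -> t <= u -> Kreal t x <= Kreal u x.
Proof.
move=> t0 tu; apply: Kreal_ge => [|b0 b1 xb]; first exact: le_trans tu.
apply: le_trans (Kreal_le _ _ _ _ t0 xb) _.
by rewrite lerD2l ler_wpM2r ?rnorm_ge0.
Qed.

(** For a fixed decomposition the cost divided by [t] is [|b0| / t + |b1|], which does not increase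
    with [t]. *)
Lemma Kreal_div_mono t u x : 0 < t -> t <= u -> Kreal u x / u <= Kreal t x / t.
Proof.
move=> t0 tu; have u0 := lt_le_trans t0 tu.
rewrite ler_pdivrMr// mulrAC ler_pdivlMr// -ler_pdivrMr//.
apply: Kreal_ge => [|b0 b1 xb]; first exact: ltW.
rewrite ler_pdivrMr//.
apply: le_trans (ler_wpM2r (ltW t0) (Kreal_le _ _ _ _ (ltW u0) xb)) _.
rewrite !mulrDl [leLHS]addrC [leRHS]addrC mulrAC (mulrAC t) (mulrC u t).
by rewrite lerD2l ler_wpM2l ?rnorm_ge0.
Qed.

End K_functional_theory.

(** * Bounds from below and above for the norm of a functor of exponent theta *)

Section functor_bounds.
Context {R : realType} {s : scalars} (A : banach_pair R s).
Hypothesis ordA : ordered A.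
Local Notation K := (scalar_field R s).
Local Notation e0 := (emb (space0 A)).
Local Notation e1 := (emb (space1 A)).
Context (I : exact_functor R s) (theta : R).
Hypothesis charI : has_characteristic_function I (fun t => t `^ theta).

Lemma pair_sum_ordered : pair_sum (A := A) = range e0.
Proof.
apply/seteqP; split=> [_ [a0 [a1 ->]]|_ [a0 _ <-]].
  by have [b <- _] := ordA a1; exists (a0 + b) => //; rewrite linearD.
by exists a0, 0; rewrite linear0 addr0.
Qed.

(** The seminorm [Kreal alpha] is at most the norm on A_0 and [alpha] times the norm on A_1. So a
    Hahn-Banach functional [f] for it at [x] maps A to (K, alpha^-1 K) with both norms at most 1,
    and [f x] has norm [alpha^-theta |f x|] in the functor. *)
Lemma Kreal_le_interp (alpha : R) (x : space0 A) (b : I A) : 0 < alpha ->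
  emb (I A) b = e0 x -> Kreal alpha x <= alpha `^ theta * rnorm b.
Proof.
move=> alpha0 bx; pose al : {posnum R} := PosNum alpha0.
have [f [fL fK Kf]] := hahn_banach_seminorm (Kreal alpha) x
  (fun x y => KrealD alpha x y (ltW alpha0))
  (fun k x => KrealZ alpha k x (ltW alpha0)).
(* [f] acts on A_0 but [S] must act on the ambient space: [xget] picks the preimage, with default 0
   off the range of [e0]; linearity is claimed only on that range. *)
pose S (y : ambient A) : ambient (scalar_pair s al) :=
  f (xget 0 [set z | e0 z = y]).
have SE z : S (e0 z) = f z.
  rewrite /S; congr f; apply: (emb_inj (b := space0 A)).
  by apply: (@xgetPex _ 0 [set t | e0 t = e0 z]); exists z.
have Slin : linear_on (pair_sum (A := A)) S.
  rewrite pair_sum_ordered => k _ _ [y _ <-] [z _ <-].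
  by rewrite -linearP !SE fL.
have S0 : bounded_by (space0 A) (space0 (scalar_pair s al)) S 1.
  move=> a0; exists (f a0 : scaled_line s 1%:pos); first by rewrite SE.
  rewrite rnorm_scaled !mul1r; apply: le_trans (fK a0) _.
  by rewrite Kreal_le_rnorm ?ltW.
have S1 : bounded_by (space1 A) (space1 (scalar_pair s al)) S 1.
  move=> a1; have [a0 a01 _] := ordA a1.
  exists (f a0 : scaled_line s (al%:num^-1)%:pos); first by rewrite -a01 SE.
  rewrite rnorm_scaled mul1r/= ler_pdivrMl//; apply: le_trans (fK a0) _.
  apply: le_trans (Kreal_le _ _ 0 a1 (ltW alpha0) _) _.
    by rewrite linear0 add0r a01.
  by rewrite rnorm0 add0r.
have [c cS] := interp_exact Slin S0 S1 b.
rewrite maxxx mul1r bx SE in cS * => cb.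
have := charI al (f x); rewrite -cS space_norm_emb => -[cE].
apply: le_trans Kf _; rewrite mulrC -ler_pdivrMr ?powR_gt0// mulrC.
by rewrite -cS -cE.
Qed.

(** The map [k |-> k x0] from (K, alpha^-1 K) to A has both norms at most [M], and the scalar 1 has
    norm [alpha^-theta] in the functor. *)
Lemma interp_le_J (alpha M : R) (x0 : space0 A) (x1 : space1 A) : 0 < alpha ->
  e0 x0 = e1 x1 -> rnorm x0 <= M -> alpha * rnorm x1 <= M ->
  exists2 b : I A, emb (I A) b = e0 x0 & rnorm b <= alpha `^ (- theta) * M.
Proof.
move=> alpha0 x01 M0 M1; pose al : {posnum R} := PosNum alpha0.
pose S (k : ambient (scalar_pair s al)) : ambient A := (k : K) *: e0 x0.
have Slin : linear_on (pair_sum (A := scalar_pair s al)) S.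
  by move=> k y z _ _; rewrite /S scalerDl scalerA.
have S0 : bounded_by (space0 (scalar_pair s al)) (space0 A) S M.
  move=> k; exists ((k : K) *: x0); first by rewrite linearZ.
  rewrite rnormZ rnorm_scaled mul1r mulrC ler_wpM2r//.
  exact/re_part_ge0.
have S1 : bounded_by (space1 (scalar_pair s al)) (space1 A) S M.
  move=> k; exists ((k : K) *: x1); first by rewrite linearZ/= -x01.
  rewrite rnormZ rnorm_scaled/= mulrA [leRHS]mulrC ler_wpM2l//.
    exact/re_part_ge0.
  by rewrite ler_pdivlMr// mulrC.
have [c _ c1] : range (emb (I (scalar_pair s al))) (1 : K).
  by apply: inter_sub_interp; split; exists (1 : K).
have [b bS] := interp_exact Slin S0 S1 c.
rewrite maxxx => bM; exists b; first by rewrite bS c1 /S scale1r.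
apply: le_trans bM _; rewrite mulrC.
have := charI al 1; rewrite -c1 space_norm_emb c1 => -[->].
by rewrite normr1 -(@of_real1 R s) of_realK mulr1 powRN.
Qed.

End functor_bounds.

(** * Convergence of sequences and series, measured by real-valued norms *)

Lemma rnorm_cvg {R : realType} {s : scalars}
    {V : normedModType (scalar_field R s)} (u : nat -> V) (l : V) :
  (fun n => rnorm (l - u n)) @ \oo --> 0 <-> u @ \oo --> l.
Proof.
split=> /cvgrPdist_lt ul; apply/cvgrPdist_lt => e e0.
  have e'0 : 0 < re_part e by rewrite -(@lt_of_real R s) re_partK ?of_real0 ?ltW.
  apply: filterS (ul _ e'0) => n.
  rewrite sub0r normrN ger0_norm ?rnorm_ge0// -(@lt_of_real R s) -norm_rnorm.
  by rewrite re_partK// ltW.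
have e'0 := of_real_gt0 s e0.
apply: filterS (ul _ e'0) => n.
by rewrite sub0r normrN ger0_norm ?rnorm_ge0// -(@lt_of_real R s) -norm_rnorm.
Qed.

Lemma rnorm_sum {R : realType} {s : scalars}
    {V : normedModType (scalar_field R s)} (u : nat -> V) m n :
  rnorm (\sum_(m <= k < n) u k) <= \sum_(m <= k < n) rnorm (u k).
Proof.
elim/big_ind2 : _ => [|x a y b xa yb|//]; first by rewrite rnorm0.
by apply: le_trans (rnormD _ _) _; exact: lerD.
Qed.

(** The partial sums of [w] are monotone and bounded, hence Cauchy, and their increments dominate
    those of the series of [u]. *)
Lemma rnorm_series_cvg {R : realType} {s : scalars}
    {V : completeNormedModType (scalar_field R s)} (u : nat -> V)
    (w : nat -> R) (B : R) :
  (forall n, rnorm (u n) <= w n) -> (forall n, series w n <= B) ->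
  exists2 l : V, series u @ \oo --> l & rnorm l <= B.
Proof.
move=> uw wB.
have w0 n : 0 <= w n by apply: le_trans (uw n); exact: rnorm_ge0.
have : cvgn (series w).
  apply: nondecreasing_is_cvgn; first exact: nondecreasing_series.
  by exists B => _ [n _ <-].
move=> /cauchy_cvgP/cauchy_seriesP wc.
have : cvgn (series u).
  apply/cauchy_cvgP/cauchy_seriesP => e e0.
  have e'0 : 0 < re_part e by rewrite -(@lt_of_real R s) re_partK ?of_real0 ?ltW.
  apply: filterS (wc _ e'0) => n /=; rewrite ger0_norm ?sumr_ge0// => we.
  rewrite norm_rnorm -[e]re_partK ?ltW// lt_of_real; apply: le_lt_trans we.
  by apply: le_trans (rnorm_sum _ _ _) _; exact: ler_sum.
move=> /cvg_ex[l ul]; exists l => //; apply/ler_addgt0Pr => e e0.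
have /cvgrPdist_lt/(_ _ e0)[N _ /(_ N (leqnn N))] := (rnorm_cvg _ _).2 ul.
rewrite sub0r normrN ger0_norm ?rnorm_ge0// => lN.
have := rnormD (l - series u N) (series u N); rewrite subrK => /le_trans; apply.
rewrite addrC lerD ?(ltW lN)//.
apply: le_trans (rnorm_sum _ _ _) _; apply: le_trans (wB N).
exact: ler_sum.
Qed.

(** * Bounding the interpolation norm by a sum over the points tau^(2^n) *)

Section interp_upper_bound.
Context {R : realType} {s : scalars} (A : banach_pair R s).
Hypothesis ordA : ordered A.
Local Notation e0 := (emb (space0 A)).
Local Notation e1 := (emb (space1 A)).
Context (I : exact_functor R s) (theta : R).
Hypothesis charI : has_characteristic_function I (fun t => t `^ theta).

(** [k] lies strictly above the K-functional, so every T_n = tau^(2^n) has a decomposition of cost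
    below [k], and it keeps both monotonicities. The hypothesis on [tau] makes T_n^(1-theta) at most
    r^(2^(n+1)), the weight of the next term; [2^-1 <= r] makes the first weight [2 * r] at least
    1. *)
Lemma interp_le_sum (x : space0 A) (k : R -> R) (tau r B : R) :
  (forall t, 0 < t -> Kreal t x < k t) ->
  (forall t u, 0 < t -> t <= u -> k t <= k u) ->
  (forall t u, 0 < t -> t <= u -> k u / u <= k t / t) ->
  0 < tau <= 1 -> 2^-1 <= r < 1 -> 0 <= theta -> tau `^ (1 - theta) <= r ^+ 2 ->
  (forall n, \sum_(0 <= i < n)
    2 * r ^+ (2 ^ i) * (k (tau ^+ (2 ^ i)) / tau ^+ (2 ^ i)) <= B) ->
  exists2 b : I A, emb (I A) b = e0 x & rnorm b <= B.
Proof.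
move=> Kk k_nd k_ni /andP[tau0 tau1] /andP[r_ge r1] theta0 tau_r sumB.
have r0 : 0 < r by apply: lt_le_trans r_ge; rewrite invr_gt0.
pose T n := tau ^+ (2 ^ n).
have T0 n : 0 < T n by exact: exprn_gt0.
have TS n : T n.+1 = T n ^+ 2 by rewrite /T expnS mulnC exprM.
have tau_r2 : tau <= r ^+ 2.
  by apply: le_trans tau_r; rewrite ger1_powR ?tau0// gerBl.
have TSle n : T n.+1 <= T n.
  by rewrite TS ler_piMl ?(ltW (T0 n))// exprn_ile1// ltW.
have kT0 t : 0 < t -> 0 < k t.
  by move=> t0; apply: le_lt_trans (Kk t t0); rewrite Kreal_ge0// ltW.
have Tpow n : T n `^ (1 - theta) <= r ^+ (2 ^ n.+1).
  rewrite /T -powR_mulrn ?(ltW tau0)// powRAC powR_mulrn ?powR_ge0//.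
  rewrite expnS exprM.
  by rewrite lerXn2r ?nnegrE ?powR_ge0// exprn_ge0// ltW.
have /choice[p pP] n : exists p : space0 A * space1 A,
    e0 x = e0 p.1 + e1 p.2 /\ rnorm p.1 + T n * rnorm p.2 < k (T n).
  have [b0 [b1 bP]] := Kreal_decomposition _ _ _ (ltW (T0 n)) (Kk _ (T0 n)).
  by exists (b0, b1).
have p1k n : rnorm (p n).1 <= k (T n).
  apply: le_trans (ltW (pP n).2); rewrite lerDl mulr_ge0 ?rnorm_ge0//.
  exact: ltW.
have p2k n : rnorm (p n).2 <= k (T n) / T n.
  rewrite ler_pdivlMr// mulrC; apply: le_trans (ltW (pP n).2).
  by rewrite lerDr rnorm_ge0.
pose w n := 2 * r ^+ (2 ^ n) * (k (T n) / T n).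
(* Shifted by one index: [x_ 0 - x_ 1] is y_0 and [x_ n.+1 - x_ n.+2] is y_(n+1) - y_n, all of them
   in A_1. *)
pose x_ n := if n is n.+1 then (p n).1 else x.
have c_ex n : exists c : I A,
    emb (I A) c = e0 (x_ n - x_ n.+1) /\ rnorm c <= w n.
  case: n => [|n].
    have e01 : e0 (x_ 0 - x_ 1) = e1 (p 0).2.
      by rewrite linearB/= {1}(pP 0).1 addrAC subrr add0r.
    have [b b1 b_le] := ordA (p 0).2.
    rewrite -e01 in b1; move/(@emb_inj _ _ _ (space0 A)) : b1 => b1.
    (* The first term is estimated at the point 1: the embedding has norm at most 1, so both norms
       of y_0 are at most k(T_0) / T_0. *)
    have [||c cE c_le] :=
        interp_le_J A I theta charI 1 (k (T 0) / T 0) _ _ ltr01 e01.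
    - by rewrite -b1; apply: le_trans b_le _; rewrite mul1r.
    - by rewrite mul1r.
    - exists c; split => //; apply: le_trans c_le _.
      rewrite powR1 mul1r /w ler_peMl//; first by rewrite divr_ge0// ltW// kT0.
      by rewrite expn0 expr1; lra.
  have e01 : e0 (x_ n.+1 - x_ n.+2) = e1 ((p n.+1).2 - (p n).2).
    rewrite !linearB/=; apply/eqP; rewrite subr_eq addrAC eq_sym subr_eq eq_sym.
    by rewrite -(pP n).1 addrC -(pP n.+1).1.
  have kS : k (T n) / T n <= k (T n.+1) / T n.+1 by exact: k_ni.
  have kS' : k (T n) <= T n * (k (T n.+1) / T n.+1).
    by rewrite -ler_pdivrMl// mulrC.
  (* By the two monotonicities, [k (T n.+1) <= k (T n) <= T n * (k (T n.+1) / T n.+1)]; the factor 2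
     accounts for the two pieces of each difference. *)
  have [||c cE c_le] := interp_le_J A I theta charI (T n)
    (2 * (T n * (k (T n.+1) / T n.+1))) _ _ (T0 n) e01.
  - apply: le_trans (rnormD _ _) _; rewrite rnormN.
    have := p1k n; have := p1k n.+1; have := k_nd _ _ (T0 n.+1) (TSle n); lra.
  - rewrite mulrCA ler_wpM2l ?(ltW (T0 n))//.
    apply: le_trans (rnormD _ _) _; rewrite rnormN.
    have := p2k n; have := p2k n.+1; lra.
  - exists c; split => //; apply: le_trans c_le _.
    rewrite mulrCA /w -mulrA ler_wpM2l// (mulrA _ (T n) (_ / _)).
    rewrite ler_wpM2r// ?divr_ge0 ?(ltW (T0 _))// ?(ltW (kT0 _ _))//.
    rewrite mulrC -{1}[T n]powRr1 ?(ltW (T0 n))// -powRD; last first.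
      by rewrite (gt_eqF (T0 n)) implybT.
    exact: Tpow.
have [c cP] := choice c_ex.
have [b cb bB] := rnorm_series_cvg c w B (fun n => (cP n).2) sumB.
exists b => //.
have cE n : emb (I A) (series c n) = e0 (x - x_ n).
  elim: n => [|n IHn]; first by rewrite /series/= big_geq// subrr !linear0.
  rewrite /series/= big_nat_recr//= linearD/= -/(series c n) IHn (cP n).1.
  by rewrite -linearD/= addrA subrK.
(* The partial sums converge in the ambient space both to the image of [b] and, as [x_ n] tends to 0
   in A_0, to that of [x]; the Hausdorff property identifies the limits. *)
have eb : (fun n => e0 (x - x_ n)) @ \oo --> emb (I A) b.
  rewrite -(_ : emb (I A) \o series c = fun n => e0 (x - x_ n)); last first.
    by apply/funext => n; exact: cE.
  exact: (continuous_cvg _ (@emb_continuous _ _ _ (I A) b) cb).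
have x_x : (fun n => x - x_ n) @ \oo --> x.
  apply/rnorm_cvg; rewrite -cvg_shiftS/=.
  (* The single summand [w n <= B] together with T_n <= r^(2 * 2^n) gives k(T_n) <= B r^(2^n), and n
     <= 2^n. *)
  have k_le n : k (T n) <= B * r ^+ n.
    have w0 m : 0 <= w m.
      rewrite mulr_ge0 ?divr_ge0 ?(ltW (kT0 _ _)) ?(ltW (T0 _))//.
      by rewrite mulr_ge0 ?exprn_ge0 ?ltW.
    have B0 : 0 <= B by apply: le_trans (sumB 0); rewrite big_geq.
    have wB : w n <= B.
      by apply: le_trans (sumB n.+1); rewrite big_nat_recr//= lerDr;
        apply: sumr_ge0 => i _; exact: w0.
    have rn0 : 0 < r ^+ (2 ^ n) by exact: exprn_gt0.
    have TB : k (T n) * (2 * r ^+ (2 ^ n)) <= B * T n.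
      by rewrite -ler_pdivrMr// -mulrA mulrC -mulrA; move: wB; rewrite /w; lra.
    have Tr : T n <= r ^+ (2 ^ n) * r ^+ (2 ^ n).
      rewrite -expr2 -exprM mulnC exprM lerXn2r ?nnegrE ?(ltW tau0)//.
      by rewrite exprn_ge0// ltW.
    have {}TB := le_trans TB (ler_wpM2l B0 Tr).
    have : k (T n) <= B * r ^+ (2 ^ n).
      rewrite -(ler_pM2r rn0) -mulrA; apply: le_trans TB.
      by rewrite ler_wpM2l ?(ltW (kT0 _ _))// ler_peMl ?ler1n// ltW.
    move=> /le_trans; apply; rewrite ler_wpM2l// ler_wiXn2l ?(ltW r0) ?(ltW r1)//.
    exact/ltnW/ltn_expl.
  apply: (@squeeze_cvgr _ _ _ _ (cst 0) (fun n => B * r ^+ n)).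
  - apply: nearW => n; rewrite opprB addrC subrK rnorm_ge0/=.
    exact: le_trans (p1k n) (k_le n).
  - exact: cvg_cst.
  - rewrite -[X in _ --> X](mulr0 B); apply: cvgMr.
    by apply: cvg_expr; rewrite ger0_norm// ltW.
have ex : (fun n => e0 (x - x_ n)) @ \oo --> e0 x.
  exact: (continuous_cvg _ (@emb_continuous _ _ _ (space0 A) x) x_x).
exact: (cvg_unique (@ambient_hausdorff _ _ A) eb ex).
Qed.

End interp_upper_bound.

(** * Superexponential weights, and almost-everywhere statements on (0,1) *)

Lemma sum_expr2n_bounded {R : realType} (r M : R) : 0 < r < 1 -> 0 <= M ->
  exists2 D, 0 <= D &
    forall n, \sum_(0 <= i < n) 2 * r ^+ (2 ^ i) * M ^+ i <= D.
Proof.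
move=> /andP[r0 r1] M0.
pose w i := 2 * r ^+ (2 ^ i) * M ^+ i.
have w0 i : 0 <= w i.
  by rewrite mulr_ge0 ?exprn_ge0// mulr_ge0// exprn_ge0// ltW.
have : (fun n => M * r ^+ n) @ \oo --> M * 0.
  by apply: cvgMr; apply: cvg_expr; rewrite ger0_norm// ltW.
rewrite mulr0 => /cvgrPdist_lt/(_ 2^-1); rewrite invr_gt0 ltr0n => /(_ erefl)[N _ MN].
(* The ratio of consecutive terms is M r^(2^n), at most 1/2 from [N] on; hence the partial sum plus
   twice the next term no longer increases. *)
have wS n : (N <= n)%N -> w n.+1 <= w n / 2.
  move=> Nn; have -> : w n.+1 = w n * (M * r ^+ (2 ^ n)).
    by rewrite /w expnS mulnC exprM (exprS M) expr2; ring.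
  rewrite ler_wpM2l//.
  have := MN (2 ^ n)%N (leq_trans Nn (ltnW (ltn_expl n (isT : (1 < 2)%N)))).
  by rewrite sub0r normrN ger0_norm ?mulr_ge0 ?exprn_ge0 ?(ltW r0)// => /ltW.
have bound n : (N <= n)%N -> series w n + 2 * w n <= series w N + 2 * w N.
  elim: n => [|n IHn]; first by rewrite leqn0 => /eqP ->.
  rewrite leq_eqVlt => /predU1P[->//|Nn]; apply: le_trans (IHn Nn).
  rewrite /series/= big_nat_recr//= -/(series w n).
  by have := wS n Nn; lra.
exists (series w N + 2 * w N) => [|n].
  by apply: addr_ge0; [exact: sumr_ge0 | exact: mulr_ge0].
rewrite -/(series w n); have [nN|Nn] := leqP n N.
  apply: (@le_trans _ _ (series w N)); last by rewrite lerDl mulr_ge0.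
  exact: (@nondecreasing_series _ w xpredT 0 (fun n _ _ => w0 n) _ _ nN).
by apply: le_trans (bound n (ltnW Nn)); rewrite lerDl mulr_ge0.
Qed.

Lemma ae01_imply {R : realType} (P Q : R -> Prop) :
  (forall t, 0 < t < 1 -> P t -> Q t) -> ae01 P -> ae01 Q.
Proof.
move=> PQ [N [mN N0 NP]]; exists N; split => // t nQ; apply: NP => Pt.
by apply: nQ => t01; exact: PQ (Pt t01).
Qed.

Lemma ae01I {R : realType} (P Q : R -> Prop) :
  ae01 P -> ae01 Q -> ae01 (fun t => P t /\ Q t).
Proof.
move=> aP aQ.
have := @filterI _ _ (ae_filter_ringOfSetsType (@lebesgue_measure R)) _ _ aP aQ.
apply: (@filterS _ _ (ae_filter_ringOfSetsType _)) => t [Pt Qt] t01.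
by split; [exact: Pt | exact: Qt].
Qed.

Lemma ae01_exists {R : realType} (P : R -> Prop) (a b : R) :
  0 <= a -> a < b -> b <= 1 -> ae01 P -> exists2 t, a < t < b & P t.
Proof.
move=> a0 ab b1 [N [mN N0 PN]]; apply: contrapT => nP.
suff : (lebesgue_measure `]a, b[%classic <= (0 : \bar R))%E.
  by rewrite lebesgue_measure_itv/= lte_fin ab -EFinB lee_fin subr_le0 leNgt ab.
rewrite -N0; apply: le_measure; rewrite ?inE// => t/=.
rewrite in_itv/= => tab; apply: PN => /= Pt; apply: nP; exists t => //.
by apply: Pt; case/andP: tab => at_ tb; rewrite (le_lt_trans a0)// (lt_le_trans tb).
Qed.

(** * Series in a Banach lattice and iterates of T *)

Section lattice_theory.
Context {R : realType} (F : banach_lattice R).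
Implicit Types f g k : R -> R.

Lemma lnormN f : lcar F f -> lcar F (\- f) /\ lnorm F (\- f) = lnorm F f.
Proof.
move=> Ff; have -> : \- f = (-1) \*o f by apply/funext => t /=; rewrite mulN1r.
by split; [exact: lcarZ | rewrite lnormZ// normrN1 mul1r].
Qed.

Lemma lnormB f g : lcar F f -> lcar F g ->
  lcar F (f \- g) /\ lnorm F (f \- g) <= lnorm F f + lnorm F g.
Proof.
move=> Ff Fg; have [FNg <-] := lnormN _ Fg.
by split; [exact: (lcarD Ff FNg) | exact: (lnormD Ff FNg)].
Qed.

Lemma lnorm0 : lnorm F (cst 0) = 0.
Proof.
have := @lnormZ _ F 0 _ (lcar0 F); rewrite normr0 mul0r.
by have -> : 0 \*o cst 0 = cst 0 :> (R -> R)
  by apply/funext => t /=; rewrite mul0r.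
Qed.

Lemma lnorm_ge0 f : lcar F f -> 0 <= lnorm F f.
Proof.
move=> Ff; have := (lnormB _ _ Ff Ff).2.
have -> : f \- f = cst 0 by apply/funext => t /=; rewrite subrr.
by rewrite lnorm0; lra.
Qed.

Lemma lcar_sum (u : nat -> R -> R) m n : (forall n, lcar F (u n)) ->
  lcar F (fun t => \sum_(m <= i < n) u i t) /\
  lnorm F (fun t => \sum_(m <= i < n) u i t) <= \sum_(m <= i < n) lnorm F (u i).
Proof.
move=> Fu; rewrite -fct_sumE.
elim/big_ind2 : _ => [|x a y b [Fx xa] [Fy yb]|//].
  by split; [exact: lcar0 | rewrite lnorm0].
split; first exact: lcarD.
by apply: le_trans (lnormD Fx Fy) _; exact: lerD.
Qed.

Lemma lattice_norm_le (g : R -> \bar R) (h : R -> R) : lcar F h ->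
  ae01 (fun t => (`|g t| <= (h t)%:E)%E) ->
  (lattice_norm F g <= (lnorm F h)%:E)%E.
Proof. by move=> Fh gh; apply: ereal_inf_lbound; exists h. Qed.

(** Completeness gives the sum [f]; the embedding in L^oo turns norm convergence into convergence
    almost everywhere, and nonnegative terms keep each partial sum below the limit. *)
Lemma lattice_series (u : nat -> R -> R) (v : nat -> R) (B C : R) :
  (forall f, lcar F f -> ae01 (fun t => `|f t| <= C * lnorm F f)) ->
  (forall n, lcar F (u n)) -> (forall n t, 0 < t < 1 -> 0 <= u n t) ->
  (forall n, lnorm F (u n) <= v n) -> (forall n, series v n <= B) ->
  exists f, [/\ lcar F f, lnorm F f <= B &
    ae01 (fun t => forall n, \sum_(0 <= i < n) u i t <= f t)].
Proof.
move=> FLoo Fu u0 uv vB.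
pose S n t := \sum_(0 <= i < n) u i t.
have v0 n : 0 <= v n by apply: le_trans (uv n); exact: lnorm_ge0.
have FS n : lcar F (S n) by exact: (lcar_sum _ _ _ Fu).1.
have vc : cvgn (series v).
  apply: nondecreasing_is_cvgn; first exact: nondecreasing_series.
  by exists B => _ [n _ <-].
have SB m n : (n <= m)%N -> lnorm F (S m \- S n) <= series v m - series v n.
  move=> nm; have -> : S m \- S n = fun t => \sum_(n <= i < m) u i t.
    apply/funext => t; rewrite /S/= (big_cat_nat (leq0n n) nm)/=.
    by rewrite addrAC subrr add0r.
  apply: le_trans (lcar_sum _ _ _ Fu).2 _.
  by rewrite /series/= (big_cat_nat (leq0n n) nm)/= addrAC subrr add0r ler_sum.
have [|f Ff Sf] := lattice_complete FS.
  move=> e e0; have e20 : 0 < e / 2 by rewrite divr_gt0.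
  have /cvgrPdist_lt/(_ _ e20)[N _ vN] := vc.
  exists N => m n Nm Nn.
  wlog nm : m n Nm Nn / (n <= m)%N.
    move=> h; have [nm|/ltnW mn] := leqP n m; first exact: h.
    rewrite -(lnormN _ (lnormB _ _ (FS m) (FS n)).1).2.
    have -> : \- (S m \- S n) = S n \- S m by apply/funext => t /=; rewrite opprB.
    exact: h.
  apply: le_lt_trans (SB _ _ nm) _.
  have := vN m Nm; have := vN n Nn.
  by rewrite !ltr_norml; lra.
exists f; split => //.
  apply/ler_addgt0Pr => e e0.
  have /cvgrPdist_lt/(_ _ e0)[N _ /(_ N (leqnn N))] := Sf.
  have [FSf _] := lnormB _ _ (FS N) Ff.
  rewrite sub0r normrN ger0_norm ?lnorm_ge0// => Nf.
  have -> : f = S N \- (S N \- f) by apply/funext => t /=; rewrite subKr.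
  apply: le_trans (lnormB _ _ (FS N) FSf).2 _; rewrite lerD ?(ltW Nf)//.
  apply: le_trans (lcar_sum _ _ _ Fu).2 _; apply: le_trans (vB N).
  exact: ler_sum.
have FSf n := FLoo _ (lnormB _ _ (FS n) Ff).1.
(* The countably many exceptional null sets are discarded together. *)
have /ae_foralln := FSf.
apply: filterS => t tP t01 n; apply/ler_addgt0Pr => e e0.
have : (fun n => C * lnorm F (S n \- f)) @ \oo --> C * 0 by exact: cvgMr.
rewrite mulr0 => /cvgrPdist_lt/(_ _ e0)[N _ CN].
have := CN (maxn n N) (leq_maxr _ _); rewrite sub0r normrN => /ltr_normlW Ce.
have := le_lt_trans (tP (maxn n N) t01) Ce; rewrite ltr_norml => /andP[_ Se].
have : S n t <= S (maxn n N) t.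
  rewrite /S (big_cat_nat (leq0n n) (leq_maxl n N))/= lerDl.
  by apply: sumr_ge0 => i _; exact: u0.
by move: Se; rewrite /S/=; lra.
Qed.

(** The successive denominators t, t^2, ..., t^(2^(n-1)) multiply to t^(2^n - 1). *)
Lemma iter_halving f n t : t != 0 ->
  iter n (fun (f : R -> R) (t : R) => f (t ^+ 2) / t) f t =
  t * (f (t ^+ (2 ^ n)) / t ^+ (2 ^ n)).
Proof.
move=> t0; elim: n t t0 => [|n IHn] t t0.
  by rewrite expn0 expr1 mulrCA divff ?mulr1.
rewrite iterS IHn ?expf_neq0// -exprM -expnS.
rewrite expr2 -!mulrA; congr (_ * _); rewrite mulrCA; congr (_ * _).
by rewrite mulrCA divff// mulr1.
Qed.

(** Times [t], the i-th summand is 2 r^(2^i) T^i k, of norm at most 2 r^(2^i) M'^i times that of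
    [k]. [D] is fixed before [k], so that the final constants do not depend on the pair or the
    functors. *)
Lemma lattice_majorant (r : R) : is_parameter F ->
  bounded_on F (fun (f : R -> R) (t : R) => f (t ^+ 2) / t) -> 0 < r < 1 ->
  exists2 D, 0 <= D & forall k, lcar F k -> (forall t, 0 < t < 1 -> 0 <= k t) ->
    exists f, [/\ lcar F f, lnorm F f <= D * lnorm F k &
    ae01 (fun t => forall n, \sum_(0 <= i < n)
      2 * r ^+ (2 ^ i) * (k (t ^+ (2 ^ i)) / t ^+ (2 ^ i)) <= f t / t)].
Proof.
move=> [_ [C FLoo]] [M TM] r01; have [r0 r1] := andP r01.
pose T (f : R -> R) (t : R) := f (t ^+ 2) / t.
pose M' := Num.max M 0; have M'0 : 0 <= M' by rewrite le_max lexx orbT.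
have [D D0 sumD] := sum_expr2n_bounded r M' r01 M'0.
exists D => // k Fk k0.
have iterT n : lcar F (iter n T k) /\ lnorm F (iter n T k) <= M' ^+ n * lnorm F k.
  elim: n => [|n [Fn nn]]; first by rewrite expr0 mul1r.
  have [FT Tn] := TM _ Fn; split=> //; apply: le_trans Tn _.
  apply: (@le_trans _ _ (M' * lnorm F (iter n T k))).
    by rewrite ler_wpM2r ?lnorm_ge0// le_max lexx.
  by rewrite exprS -mulrA ler_wpM2l.
pose u n := (2 * r ^+ (2 ^ n)) \*o iter n T k.
have b0 n : 0 <= 2 * r ^+ (2 ^ n) by rewrite mulr_ge0// exprn_ge0// ltW.
have [|n t /andP[t0 t1]|n|n|f [Ff fD fu]] := lattice_series u
  (fun n => 2 * r ^+ (2 ^ n) * M' ^+ n * lnorm F k) (D * lnorm F k) C FLoo.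
- by move=> n; apply: lcarZ; exact: (iterT n).1.
- rewrite /u/= mulr_ge0// /T iter_halving ?gt_eqF//.
  rewrite mulr_ge0 ?(ltW t0)// divr_ge0 ?exprn_ge0 ?(ltW t0)//.
  by rewrite k0// exprn_gt0//= exprn_ilt1 ?(ltW t0)// -lt0n expn_gt0.
- rewrite lnormZ; last exact: (iterT n).1.
  by rewrite ger0_norm// -mulrA ler_wpM2l//; exact: (iterT n).2.
- by rewrite /series/= -mulr_suml ler_wpM2r ?lnorm_ge0.
exists f; split => //; apply: ae01_imply fu => t t01 tP n.
have t0 : 0 < t by case/andP: t01.
rewrite ler_pdivlMr// mulr_suml; apply: le_trans (tP n).
rewrite le_eqVlt; apply/orP; left; apply/eqP; apply: eq_bigr => i _.
by rewrite /u/= /T iter_halving ?gt_eqF//; ring.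
Qed.

End lattice_theory.

(** * Estimates for the exponent theta(t) *)

Section theta_at.
Context {R : realType}.

Definition theta_at (t : R) := 1 + (2 * ln (t / expR 1))^-1.

Section bounds.
Variable t : R.
Hypothesis t01 : 0 < t < 1.

Let t0 : 0 < t. Proof. by case/andP: t01. Qed.

Let lt0 : ln t < 0. Proof. exact: ln_lt0. Qed.

Lemma theta_atE : theta_at t = 1 - (2 * (1 - ln t))^-1.
Proof.
rewrite /theta_at lnM ?posrE ?invr_gt0 ?expR_gt0// lnV ?posrE ?expR_gt0// expRK.
by rewrite -invrN -mulrN opprB.
Qed.

Lemma theta_at_itv : 0 < theta_at t < 1.
Proof.
rewrite theta_atE subr_gt0 ltrBlDr ltrDl invr_gt0 invf_lt1; last first.
  by move: lt0; lra.
by apply/andP; split; move: lt0; lra.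
Qed.

(** t^theta(t) = t exp(- log t / (2 (1 - log t))), and this exponent is below 1/2. *)
Lemma powR_theta_at_le : t `^ theta_at t <= expR 2^-1 * t.
Proof.
rewrite -{3}[t]lnK ?posrE// /powR gt_eqF// -expRD ler_expR theta_atE.
rewrite mulrBl mul1r addrC lerD2r -mulrN mulrC.
by move: lt0 => ?; rewrite ler_pdivrMr; lra.
Qed.

(** u^(1-theta(t)) = exp(log u / (2 (1 - log t))) <= exp(-1/4). The condition on [u] covers
    [u = t <= 1/e] as well as a fixed [u <= 1/e] for [t >= 1/e]. *)
Lemma powR_1B_theta_at_le (u : R) : 0 < u -> ln u <= - (1 - ln t) / 2 ->
  u `^ (1 - theta_at t) <= expR (- 8^-1) ^+ 2.
Proof.
move=> u0 ut; rewrite -expRM_natl /powR gt_eqF// ler_expR.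
rewrite theta_atE opprB addrC subrK.
rewrite mulrC; move: lt0 => ?; rewrite ler_pdivrMr; lra.
Qed.

End bounds.
End theta_at.

(** * The equivalence of the two norms *)

Theorem theorem3 (R : realType) (s : scalars) (F : banach_lattice R)
    (hF : is_parameter F)
    (hT : bounded_on F (fun (f : R -> R) (t : R) => f (t ^+ 2) / t)) :
  exists c C : R, [/\ 0 < c, 0 < C &
    forall A : banach_pair R s, ordered A -> gagliardo_complete A ->
    forall I : R -> exact_functor R s,
      (forall theta : R, 0 < theta < 1 ->
         has_characteristic_function (I theta) (fun t => t `^ theta)) ->
    forall a : ambient A, pair_sum a ->
      let theta t := 1 + (2 * ln (t / expR 1))^-1 in
      let N := lattice_norm F (fun t => (t%:E * space_norm (I (theta t) A) a)%E) in
      (c%:E * K_method_norm F a <= N)%E /\ (N <= C%:E * K_method_norm F a)%E].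
Proof.
have [[C1 id_le] [C2 FLoo]] := hF.
have [Fid id_C1] : lcar F id /\ lnorm F id <= C1.
  rewrite -[leRHS]mulr1; apply: id_le; first exact: measurable_id.
  by apply: aeW => t /andP[t0 _]; rewrite divff ?gt_eqF// normr1.
have C1_ge0 : 0 <= C1 by apply: le_trans id_C1; exact: lnorm_ge0.
pose r : R := expR (- 8^-1).
have r1 : r < 1 by rewrite expR_lt1 oppr_lt0 invr_gt0.
have r_ge : 2^-1 <= r.
  by apply: le_trans (expR_ge1Dx _); lra.
have r0 : 0 < r by exact: expR_gt0.
have [|D D0 maj] := lattice_majorant F r hF hT; first by rewrite r0.
pose C2' := Num.max C2 0.
have C2'0 : 0 <= C2' by rewrite le_max lexx orbT.
have {}FLoo f : lcar F f -> ae01 (fun t => `|f t| <= C2' * lnorm F f).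
  move=> Ff; apply: ae01_imply (FLoo f Ff) => t _ /le_trans; apply.
  by rewrite ler_wpM2r ?lnorm_ge0// le_max lexx.
(* The majorant built below is f + c3 t with |f| <= D |k|, c3 = e^2 C2' |f| and |t| <= C1 in F, so
   its norm is at most E |k|. *)
pose E := (1 + expR 2 * C2' * C1) * D.
have E1 : 0 <= 1 + expR 2 * C2' * C1.
  by rewrite addr_ge0// !mulr_ge0// expR_ge0.
have E0 : 0 <= E by rewrite mulr_ge0.
(* The lower constant comes from t^theta(t) <= e^(1/2) t. [E] may vanish, hence [E + 1]. *)
exists (expR (- 2^-1)), (E + 1); split; rewrite ?expR_gt0 ?ltr_wpDl//.
move=> A ordA _ I charI a; rewrite (pair_sum_ordered A ordA) => -[x _ <-] theta N.
split.
  (* If [h] majorises t times the interpolation norm, then e^(1/2) h majorises the K-functional. *)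
  apply: le_ereal_inf_tmp => _ [h [Fh hN] <-].
  rewrite expRN lee_pdivrMl ?expR_gt0// -EFinM.
  have <- : lnorm F (expR 2^-1 \*o h) = expR 2^-1 * lnorm F h.
    by rewrite lnormZ// ger0_norm// expR_ge0.
  apply: ereal_inf_lbound; exists (expR 2^-1 \*o h) => //; split; first exact: lcarZ.
  apply: ae01_imply hN => t t01; have t0 : 0 < t by case/andP: t01.
  rewrite K_functionalE ?(ltW t0)//= lee_fin ger0_norm ?Kreal_ge0 ?(ltW t0)//.
  have [[b bx]|nb] := pselect (exists b, emb (I (theta t) A) b = emb (space0 A) x).
    rewrite -bx space_norm_emb -EFinM/= lee_fin => /(le_trans (ler_norm _)) bh.
    have th01 := theta_at_itv t t01.
    apply: le_trans (Kreal_le_interp A ordA _ _ (charI _ th01) t x b t0 bx) _.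
    apply: le_trans (ler_wpM2r (rnorm_ge0 b) (powR_theta_at_le t t01)) _.
    by rewrite -mulrA ler_wpM2l ?expR_ge0.
  (* Outside the interpolation space the norm is +oo, which contradicts the finite majorant
     [h t]. *)
  rewrite /space_norm [X in ereal_inf X](_ : _ = set0) ?ereal_inf0.
    by rewrite gt0_muley ?lte_fin.
  by apply/seteqP; split => // y [b bx _]; apply: nb; exists b.
rewrite -lee_pdivrMl ?ltr_wpDl//.
apply: le_ereal_inf_tmp => _ [h [Fh hK] <-].
rewrite lee_pdivrMl ?ltr_wpDl// -EFinM.
apply: (@le_trans _ _ (E * lnorm F h)%:E); last first.
  by rewrite lee_fin ler_wpM2r ?lnorm_ge0// lerDl.
apply/lee_addgt0Pr => e e0; rewrite -EFinD.
(* Truncated at 0 so as to be monotone, hence measurable, on all of R. *)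
pose Kx t := Kreal (Num.max t 0) x.
have Kx_nd : nondecreasing_fun Kx.
  move=> t u tu; apply: Kreal_mono; first by rewrite le_max lexx orbT.
  by rewrite ge_max !le_max tu lexx orbT.
have KxE t : 0 < t -> Kx t = Kreal t x.
  by move=> t0; rewrite /Kx max_l// ltW.
have [FKx Kxh] : lcar F Kx /\ lnorm F Kx <= lnorm F h.
  apply: (lattice_ideal _ Fh); first exact: nondecreasing_measurable.
  apply: ae01_imply hK => t /andP[t0 _].
  rewrite K_functionalE ?(ltW t0)//= lee_fin KxE//.
  by move=> /le_trans; apply; exact: ler_norm.
(* The slack d t makes K(t,a) < k t, so that nearly optimal decompositions
   exist even when K(t,a) = 0. *)
pose d := e / (E * C1 + 1).
have d0 : 0 < d by rewrite divr_gt0// ltr_wpDl// mulr_ge0.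
pose k := Kx \+ (d \*o id).
have Fd : lcar F (d \*o id) by exact: lcarZ.
have Fk : lcar F k by exact: lcarD.
have k_le : lnorm F k <= lnorm F h + d * C1.
  apply: le_trans (lnormD FKx Fd) _; rewrite lerD// lnormZ// gtr0_norm//.
  by rewrite ler_wpM2l// ltW.
have kE t : 0 < t -> k t = Kreal t x + d * t by move=> t0; rewrite /k/= KxE.
have Kk t : 0 < t -> Kreal t x < k t.
  by move=> t0; rewrite kE// ltrDl mulr_gt0.
have k_nd t u : 0 < t -> t <= u -> k t <= k u.
  by move=> t0 tu; rewrite /k/= lerD ?Kx_nd// ler_wpM2l// ltW.
have k_ni t u : 0 < t -> t <= u -> k u / u <= k t / t.
  move=> t0 tu; have u0 := lt_le_trans t0 tu.
  rewrite !kE// !mulrDl !mulfK ?gt_eqF// lerD2r; exact: Kreal_div_mono.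
have k0 t : 0 < t < 1 -> 0 <= k t.
  by move=> /andP[t0 _]; apply: le_trans (ltW (Kk t t0)); rewrite Kreal_ge0// ltW.
have [f [Ff fD fsum]] := maj k Fk k0.
(* Both almost-everywhere bounds hold together at some point of this interval of positive length.
   Its right end makes [t'] admissible for all t > 1/e, and its left end bounds 1/t' by e^2. *)
have [t' t'_itv [t'f t'sum]] : exists2 t' : R, expR (-2) < t' < expR (-1) &
    `|f t'| <= C2' * lnorm F f /\ forall n, \sum_(0 <= i < n)
      2 * r ^+ (2 ^ i) * (k (t' ^+ (2 ^ i)) / t' ^+ (2 ^ i)) <= f t' / t'.
  apply: ae01_exists; last exact: ae01I (FLoo f Ff) fsum.
  - exact: expR_ge0.
  - by rewrite ltr_expR; lra.
  - by rewrite expR_le1; lra.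
have /andP[t'_gt t'_lt] := t'_itv.
have t'0 : 0 < t' by apply: lt_trans t'_gt; exact: expR_gt0.
pose c3 := expR 2 * (C2' * lnorm F f).
have c30 : 0 <= c3 by rewrite !mulr_ge0 ?expR_ge0 ?lnorm_ge0.
pose g := f \+ (c3 \*o id).
have Fc3 : lcar F (c3 \*o id) by exact: lcarZ.
have Fg : lcar F g by exact: lcarD.
(* The point [tau] will be [t] itself for t <= 1/e, and [t'] otherwise. *)
have interp_le (t tau B : R) : 0 < t < 1 -> 0 < tau ->
    ln tau <= - (1 - ln t) / 2 ->
    (forall n, \sum_(0 <= i < n) 2 * r ^+ (2 ^ i) *
      (k (tau ^+ (2 ^ i)) / tau ^+ (2 ^ i)) <= B) ->
    (`|t%:E * space_norm (I (theta t) A) (emb (space0 A) x)| <= (t * B)%:E)%E.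
  move=> t01 tau0 taut sumB.
  have t0 : 0 < t by case/andP: t01.
  have th01 := theta_at_itv t t01.
  have [||||b <- bB] := interp_le_sum A ordA _ _ (charI _ th01) x k tau r B
    Kk k_nd k_ni _ _ _ _ sumB.
  - rewrite tau0/= -[tau]lnK ?posrE// expR_le1.
    by have := ln_lt0 t01; lra.
  - by rewrite r_ge.
  - by case/andP: th01 => /ltW.
  - exact: powR_1B_theta_at_le.
  rewrite space_norm_emb -EFinM/= lee_fin ger0_norm ?mulr_ge0 ?rnorm_ge0 ?(ltW t0)//.
  by rewrite ler_wpM2l// ltW.
apply: (@le_trans _ _ (lnorm F g)%:E).
  apply: lattice_norm_le => //; apply: ae01_imply fsum => t t01 tsum.
  have t0 : 0 < t by case/andP: t01.
  have f0 : 0 <= f t.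
    (* The empty sum already gives [0 <= f t / t]. *)
    by have := tsum 0%N; rewrite big_geq// pmulr_lge0 ?invr_gt0.
  have [te|te] := leP t (expR (-1)).
    apply: le_trans (interp_le _ _ _ t01 t0 _ tsum) _.
      have : ln t <= -1 by rewrite -[leRHS]expRK ler_ln ?posrE ?expR_gt0.
      lra.
    by rewrite lee_fin mulrCA divff ?gt_eqF// mulr1 /g/= lerDl mulr_ge0// ltW.
  apply: le_trans (interp_le _ _ _ t01 t'0 _ t'sum) _.
    have : -1 <= ln t by rewrite -[leLHS]expRK ler_ln ?posrE ?expR_gt0// ltW.
    have : ln t' <= -1 by rewrite -[leRHS]expRK ler_ln ?posrE ?expR_gt0// ltW.
    lra.
  (* [c3] dominates f(t') / t', since f(t') <= C2' |f| and 1/t' <= e^2. *)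
  rewrite lee_fin /g/= mulrC; apply: (@le_trans _ _ (c3 * t)); last by rewrite lerDr.
  rewrite ler_wpM2r ?(ltW t0)// /c3 mulrC.
  apply: ler_pM; rewrite ?invr_ge0 ?(ltW t'0)//.
  - by have := t'sum 0%N; rewrite big_geq// pmulr_lge0 ?invr_gt0.
  - rewrite -[leRHS]invrK -expRN lef_pV2 ?posrE ?expR_gt0//; exact: ltW.
  - exact: le_trans (ler_norm _) t'f.
rewrite lee_fin; apply: le_trans (lnormD Ff Fc3) _.
rewrite lnormZ// ger0_norm//.
apply: (@le_trans _ _ ((1 + expR 2 * C2' * C1) * lnorm F f)).
  rewrite mulrDl mul1r lerD2l /c3 -!mulrA ler_wpM2l ?expR_ge0// ler_wpM2l//.
  by rewrite mulrC ler_wpM2r ?lnorm_ge0.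
apply: (@le_trans _ _ (E * (lnorm F h + d * C1))).
  rewrite /E -(mulrA _ D) ler_wpM2l//.
  by apply: le_trans fD _; rewrite ler_wpM2l.
(* The choice of [d] makes E d C1 at most [e]. *)
rewrite mulrDr lerD2l /d mulrCA mulrAC ler_pdivrMr ?ltr_wpDl ?mulr_ge0//.
by rewrite ler_wpM2l ?(ltW e0)// lerDl.
Qed.
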